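(* Let $A$ be a Noetherian commutative ring, $C$ a finitely generated $A$-module and $J_1,\ldots,J_d\subseteq A$ finitely many ideals. Suppose that $\{I_n\}_{n\in \mathbb{N}_0^d}$ is a multi-filtration with respect to $J_1,\ldots,J_d$. Then there exists $k\in \mathbb{N}_0^d$ such that for all $n\in \mathbb{N}_0^d$ with $n\geq k$, $\operatorname{Ass}_A (I_nC/J^nC) = \operatorname{Ass}_A(I_kC/J^kC)$.
   Context: $\mathbb{N}_0$ denotes the non-negative integers; for $n,m\in\mathbb{N}_0^d$, $n\geq m$ means $n_i\geq m_i$ for all $1\le i\le d$. For $n=(n_1,\ldots,n_d)\in\mathbb{N}_0^d$, $J^n:=J_1^{n_1}\cdots J_d^{n_d}$. A collection of ideals $\{I_n\}_{n\in\mathbb{N}_0^d}$ of $A$ is a multi-filtration with respect to $J_1,\ldots,J_d$ if: (i) $I_{(0,\ldots,0)}=A$; (ii) $J^n\subseteq I_n$ for all $n\in\mathbb{N}_0^d$; (iii) $I_m\subseteq I_n$ for all $n\leq m$ in $\mathbb{N}_0^d$; (iv) $J^n\cdot I_h\subseteq I_{n+h}$ for all $n,h\in\mathbb{N}_0^d$. *)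

(* Defs.v *)
From HB Require Import structures.
From mathcomp Require Import all_boot all_algebra.
From mathcomp Require Import boolp classical_sets.

Set Implicit Arguments.
Unset Strict Implicit.
Unset Printing Implicit Defensive.

Import GRing.Theory.
Local Open Scope quotient_scope.
Local Open Scope classical_set_scope.
Local Open Scope ring_scope.

(* A submodule of M is a bundled [submodClosed M].  Its membership predicate  *)
(* is boolean, but [asbool] turns every Prop-valued predicate into such a     *)
(* predicate, so no decidability restriction is incurred.                     *)

(* The library's [idealr] only describes proper ideals, whereas A itself must *)
(* be allowed here; hence ideals are the submodules of the regular module.    *)
Definition ideal (A : comPzRingType) := submodClosed (A^o : lmodType A).

Section Submodules.
Context {A : comPzRingType} {M : lmodType A}.

Record submod (N : submodClosed M) :=
  Submod { submod_val :> M; submodP : submod_val \in N }.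

HB.instance Definition _ N := [isSub of submod N for @submod_val N].
HB.instance Definition _ N := [Choice of submod N by <:].
HB.instance Definition _ (N : submodClosed M) :=
  [SubChoice_isSubLmodule of submod N by <:].

Definition fullmod_pred : {pred M} := predT.
Lemma fullmod_pred_closed : submod_closed fullmod_pred.
Proof. by split. Qed.
HB.instance Definition _ :=
  GRing.isSubmodClosed.Build A M fullmod_pred fullmod_pred_closed.
Definition fullmod : submodClosed M := fullmod_pred.

Definition idmul_pred (I : ideal A) (N : submodClosed M) : {pred M} :=
  fun x => `[< exists s : seq (A * M),
    (forall p, p \in s -> p.1 \in I /\ p.2 \in N) /\
    x = \sum_(p <- s) p.1 *: p.2 >].

Lemma idmul_pred_closed I N : submod_closed (idmul_pred I N).
Proof.
split=> [|a x y /asboolP[s [sIN ->]] /asboolP[t [tIN ->]]]; apply/asboolP.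
  by exists [::]; rewrite big_nil.
exists ([seq (p.1, a *: p.2) | p <- s] ++ t); split.
  move=> p; rewrite mem_cat => /orP[/mapP[q /sIN[qI qN] ->]|/tIN //].
  by split=> //=; rewrite rpredZ.
rewrite big_cat big_map /= scaler_sumr; congr (_ + _).
by apply: eq_bigr => p _; rewrite !scalerA mulrC.
Qed.
HB.instance Definition _ I N :=
  GRing.isSubmodClosed.Build A M (idmul_pred I N) (idmul_pred_closed I N).
Definition idmul (I : ideal A) (N : submodClosed M) : submodClosed M :=
  idmul_pred I N.

Definition ann_pred (x : M) : {pred (A^o : lmodType A)} :=
  fun a => (a : A) *: x == 0.
Lemma ann_pred_closed x : submod_closed (ann_pred x).
Proof.
split=> [|a b c]; rewrite !unfold_in /ann_pred ?scale0r // => /eqP bx /eqP cx.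
by rewrite scalerDl -scalerA bx cx scaler0 addr0.
Qed.
HB.instance Definition _ x :=
  GRing.isSubmodClosed.Build A (A^o : lmodType A) (ann_pred x)
    (ann_pred_closed x).
Definition ann (x : M) : ideal A := ann_pred x.

End Submodules.

Section Quotient.
Context {A : comPzRingType} {M : lmodType A} (N : submodClosed M).

Definition zmod_pred : {pred M} := fun x => x \in N.
Lemma zmod_pred_closed : zmod_closed zmod_pred.
Proof. exact: GRing.submod_closedB (GRing.submodClosedP N). Qed.
HB.instance Definition _ :=
  GRing.isZmodClosed.Build M zmod_pred zmod_pred_closed.

Definition quotmod := Quotient.quot zmod_pred.

HB.instance Definition _ := GRing.Zmodule.on quotmod.

Lemma pi_eq (x y : M) :
  (\pi_quotmod x == \pi_quotmod y :> quotmod) = (x - y \in N).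
Proof. by rewrite -Quotient.idealrBE. Qed.

Definition qscale (a : A) (u : quotmod) : quotmod := \pi_quotmod (a *: repr u).

Lemma qscaleE a x : qscale a (\pi_quotmod x) = \pi_quotmod (a *: x).
Proof.
rewrite /qscale; apply/eqP; rewrite pi_eq -scalerBr rpredZ //.
by rewrite -pi_eq reprK; apply: eqxx.
Qed.

Lemma qscalerA a b u : qscale a (qscale b u) = qscale (a * b) u.
Proof.
by rewrite -[u]reprK (qscaleE b) (qscaleE a) (qscaleE (a * b)) scalerA.
Qed.

Lemma qscale1r : left_id 1 qscale.
Proof. by move=> u; rewrite -[u]reprK qscaleE scale1r. Qed.

Lemma qscalerDr : right_distributive qscale +%R.
Proof.
move=> a u v; rewrite -[u]reprK -[v]reprK !qscaleE -!raddfD /=.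
by rewrite qscaleE scalerDr.
Qed.

Lemma qscalerDl u : {morph qscale^~ u : a b / a + b}.
Proof. by move=> a b; rewrite -[u]reprK !qscaleE scalerDl raddfD. Qed.

HB.instance Definition _ := GRing.Zmodule_isLmodule.Build A quotmod
  qscalerA qscale1r qscalerDr qscalerDl.

End Quotient.

Section Subquotient.
Context {A : comPzRingType} {M : lmodType A} (N L : submodClosed M).

Definition comap_pred : {pred submod N} := fun x => val x \in L.
Lemma comap_pred_closed : submod_closed comap_pred.
Proof.
split=> [|a x y xL yL].
  by rewrite -topredE /= /comap_pred raddf0 rpred0.
by rewrite -topredE /= /comap_pred linearP rpredD ?rpredZ.
Qed.
HB.instance Definition _ :=
  GRing.isSubmodClosed.Build A (submod N) comap_pred comap_pred_closed.

(* N / (N :&: L), i.e. the quotient N / L when L is contained in N. *)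
Definition subquot : lmodType A := quotmod (comap_pred : submodClosed (submod N)).

End Subquotient.

Definition fg_module (A : comPzRingType) (M : lmodType A) : Prop :=
  exists (r : nat) (e : 'I_r -> M),
    forall x : M, exists c : 'I_r -> A, x = \sum_i c i *: e i.

Definition noetherian (A : comPzRingType) : Prop :=
  forall I : ideal A, fg_module (submod I).

Definition prime_ideal (A : comPzRingType) (P : ideal A) : Prop :=
  (1 : A) \notin P /\
  forall a b : A, a * b \in P -> a \in P \/ b \in P.

Definition Ass (A : comPzRingType) (M : lmodType A) : set (ideal A) :=
  [set P | prime_ideal P /\ exists x : M, P =i ann x].

Section MultiFiltration.
Context {A : comPzRingType} {d : nat}.
Implicit Types (J : 'I_d -> ideal A) (n h : {ffun 'I_d -> nat}).

Definition idealX (I : ideal A) (k : nat) : ideal A := iter k (idmul I) fullmod.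

Definition mpow J n : ideal A := \big[idmul/fullmod]_(i < d) idealX (J i) (n i).

Definition mle n h : Prop := forall i, (n i <= h i)%N.

(* The zero and the sum of multi-indices are those of the pointwise additive  *)
(* monoid structure on {ffun 'I_d -> nat}.                                    *)
Definition multi_filtration J (I : {ffun 'I_d -> nat} -> ideal A) : Prop :=
  [/\ I 0 =i fullmod,
      forall n, {subset mpow J n <= I n},
      forall n m, mle n m -> {subset I m <= I n} &
      forall n h, {subset idmul (mpow J n) (I h) <= I (n + h)}].

End MultiFiltration.

(* Main.v *)
(* The modules J^m C form a Noetherian multigraded module over the Rees       *)
(* algebra of J_1, ..., J_d, i.e. the families L_m <= J^m C of submodules     *)
(* with J_i L_m <= L_(m + e_i) satisfy the ascending chain condition. This    *)
(* has two consequences. First, there is k such that, for n >= k, an element  *)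
(* x of J^k C with J_i x <= J^(n + e_i) C lies in J^n C. Second, the modules  *)
(* J^m C / J^(m + e_j) C have altogether finitely many associated primes,     *)
(* hence so do the modules I_n C / J^n C, and it is enough to stabilize each  *)
(* prime P separately. If for some n >= k there is an x in I_n C with         *)
(* P = (J^n C : x) that lies moreover in J^k C, then multiplying x by         *)
(* suitable elements of the J_i yields such elements in all larger degrees.   *)
(* Otherwise, for m >= n >= k, an x in I_m C with P = (J^m C : x) has no      *)
(* multiple s x, s \notin P, in J^n C, so P = (J^n C : x): being associated   *)
(* in degree m implies being associated in degree n.                          *)

From HB Require Import structures.
Require Import Defs.
From mathcomp Require Import all_boot all_algebra.
From mathcomp Require Import boolp classical_sets cardinality.

Set Implicit Arguments.
Unset Strict Implicit.
Unset Printing Implicit Defensive.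

Import GRing.Theory.
Local Open Scope classical_set_scope.
Local Open Scope ring_scope.

(** The Rees module is handled as the family of submodules J^m C of C indexed by the multidegree m,
    so its elements never leave C. Its Noetherianity is [rees_acc], which comes from a Hilbert basis
    theorem for such families, [graded_basis]. Suitable chains then give [rees_colon], and a maximal
    counterexample gives [assoc_finite]. With [assoc_rees_quotient] the latter confines the
    associated primes of all I_n C / J^n C to one finite set. Each prime is settled from some degree
    on by [assoc_at_eventually], which rests on [assoc_above_homo] and [assoc_at_anti]; the
    coordinatewise maximum of the finitely many thresholds is the required k. *)

(** * Ascending chains of families of subsets *)

Section AscendingChains.
Context {I T : Type}.
Implicit Types (L : I -> set T) (F : set (I -> set T)).

Definition subfam L L' := forall i, L i `<=` L' i.

Definition acc F := forall L : nat -> I -> set T,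
  (forall t, F (L t)) -> (forall t, subfam (L t) (L t.+1)) ->
  exists s, forall t, subfam (L t) (L s).

Lemma subfam_trans L L' L'' : subfam L L' -> subfam L' L'' -> subfam L L''.
Proof. by move=> sL sL' i x /sL /sL'. Qed.

Lemma chain_homo (L : nat -> I -> set T) :
  (forall t, subfam (L t) (L t.+1)) ->
  forall s t, (s <= t)%N -> subfam (L s) (L t).
Proof.
move=> sL s t; elim: t => [|t IHt]; first by rewrite leqn0 => /eqP-> i x.
rewrite leq_eqVlt => /predU1P[->|/IHt sst]; first by move=> i x.
exact: subfam_trans sst (sL t).
Qed.

Lemma acc_sub F F' : F `<=` F' -> acc F' -> acc F.
Proof. by move=> sF accF L FL; apply: accF => t; apply: sF. Qed.

(** Without a maximal member, choice produces a strictly larger member at each step, hence a chain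
    that never stops. *)
Lemma acc_max F (Q : set (I -> set T)) L0 :
    acc F -> Q `<=` F -> Q L0 ->
  exists2 L, Q L & forall L', Q L' -> subfam L L' -> subfam L' L.
Proof.
move=> accF QF QL0; apply: contrapT => noMax.
have next (u : {L | Q L}) : exists v : {L | Q L},
    subfam (sval u) (sval v) /\ ~ subfam (sval v) (sval u).
  apply: contrapT => noNext; apply: noMax; exists (sval u); first exact: svalP.
  move=> L' QL' sL'; apply: contrapT => nsL'; apply: noNext.
  by exists (exist _ L' QL').
have [f fP] := choice next.
pose L t := sval (iter t f (exist _ L0 QL0)).
have [||s sP] := accF L.
- by move=> t; apply/QF/svalP.
- by move=> t; have [] := fP (iter t f (exist _ L0 QL0)).
by have [_] := fP (iter s f (exist _ L0 QL0)); apply; apply: sP s.+1.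
Qed.

(* The diagonal chain controls all columns beyond some index at once. *)
Lemma acc_diag F (L : nat -> nat -> I -> set T) :
    acc F -> (forall t s, F (L t s)) ->
    (forall t s, subfam (L t s) (L t.+1 s)) ->
    (forall t s, subfam (L t s) (L t s.+1)) ->
  exists r, forall t s, subfam (L t s) (L r s).
Proof.
move=> accF FL Lt Ls.
have homo t t' s s' : (t <= t')%N -> (s <= s')%N -> subfam (L t s) (L t' s').
  move=> tt' ss'; apply: (@subfam_trans _ (L t' s)).
    exact: (chain_homo (fun t => Lt t s)).
  exact: chain_homo.
have [|t|r0 r0P] := accF (fun t => L t t); [by []|exact: homo|].
have [r1 r1P] : exists r1, forall t s, (s < r0)%N -> subfam (L t s) (L r1 s).
  elim: (r0) => [|n [r1 IHn]]; first by exists 0.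
  have [||r2 r2P] := accF (fun t => L t n); [by []|by move=> t; apply: Lt|].
  exists (maxn r1 r2) => t s; rewrite ltnS leq_eqVlt => /predU1P[->|/IHn sn].
    exact: subfam_trans (r2P t) (homo _ _ _ _ (leq_maxr _ _) _).
  exact: subfam_trans (sn t) (homo _ _ _ _ (leq_maxl _ _) _).
exists (maxn r0 r1) => t s; case: (ltnP s r0) => [/r1P sr0|r0s].
  exact: subfam_trans (sr0 t) (homo _ _ _ _ (leq_maxr _ _) _).
apply: (@subfam_trans _ (L (maxn t s) (maxn t s))).
  by apply: homo; rewrite ?leq_maxl ?leq_maxr.
apply: subfam_trans (r0P _) (homo _ _ _ _ (leq_maxl _ _) r0s).
Qed.

End AscendingChains.

(** * Submodules as sets *)

Section SubmoduleSets.
Context {A : comPzRingType} {M : lmodType A}.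
Implicit Types (N L : submodClosed M) (S : set M).

Definition is_submod S :=
  S 0 /\ forall (a : A) x y, S x -> S y -> S (a *: x + y).

Lemma is_submodZ S a x : is_submod S -> S x -> S (a *: x).
Proof. by move=> [S0 SP] Sx; rewrite -[a *: x]addr0; apply: SP. Qed.

Lemma is_submodD S x y : is_submod S -> S x -> S y -> S (x + y).
Proof. by move=> [_ SP] Sx Sy; rewrite -[x]scale1r; apply: SP. Qed.

Lemma is_submodB S x y : is_submod S -> S x -> S y -> S (x - y).
Proof.
by move=> [_ SP] Sx Sy; rewrite -[x - y]addrC -scaleN1r; apply: SP.
Qed.

Lemma is_submodI S S' : is_submod S -> is_submod S' -> is_submod (S `&` S').
Proof.
move=> [S0 SP] [S'0 S'P]; split=> // a x y [Sx S'x] [Sy S'y].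
by split; [apply: SP|apply: S'P].
Qed.

Lemma is_submod_mem N : is_submod (fun x => x \in N).
Proof. by split=> [|a x y xN yN]; rewrite ?rpred0 // rpredD ?rpredZ. Qed.

(** The closure proofs are propositions, so only the predicates can differ. Leibniz equality makes
    products of ideals a monoid law and lets ideals be compared as elements of a set. *)
Lemma submodClosed_ext N L : N =i L -> N = L.
Proof.
case: N => [N [[NA] [NZ]]]; case: L => [L [[LA] [LZ]]] NL.
have eNL : N = L by apply/funext => x; exact: NL x.
move: NA NZ LA LZ {NL}; rewrite eNL => NA NZ LA LZ.
by rewrite (Prop_irrelevance NA LA) (Prop_irrelevance NZ LZ).
Qed.

Lemma is_submod_submodClosed S : is_submod S ->
  exists N, forall x, x \in N <-> S x.
Proof.
move=> [S0 SP]; have Sclosed : submod_closed (fun x => `[< S x >] : bool).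
  split=> [|a x y]; rewrite -!topredE /=; first exact/asboolP.
  by move=> /asboolP Sx /asboolP Sy; apply/asboolP/SP.
pose Smix := GRing.isSubmodClosed.Build A M (fun x => `[< S x >]) Sclosed.
pose N : submodClosed M := HB.pack (fun x => `[< S x >] : bool) Smix.
by exists N => x; split=> [/asboolP|Sx] //; apply/asboolP.
Qed.

Lemma idmul_ind (I : ideal A) N S : is_submod S ->
  (forall a x, a \in I -> x \in N -> S (a *: x)) ->
  forall x, x \in idmul I N -> S x.
Proof.
move=> [S0 SP] SIN x /asboolP[s [sIN ->]].
elim: s sIN => [|p s IHs] sIN; first by rewrite big_nil.
rewrite big_cons -[p.1 *: _]scale1r; apply: SP.
  by have [] := sIN p (mem_head _ _); apply: SIN.
by apply: IHs => q sq; apply: sIN; rewrite inE sq orbT.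
Qed.

Lemma idmul_mem (I : ideal A) N a x :
  a \in I -> x \in N -> a *: x \in idmul I N.
Proof.
move=> aI xN; apply/asboolP; exists [:: (a, x)].
by split=> [p|]; rewrite ?big_seq1 // inE => /eqP->.
Qed.

End SubmoduleSets.

(** * Noetherian rings and finitely generated modules *)

Section Noetherian.
Context {A : comPzRingType} (noethA : noetherian A).

Lemma noetherian_gens (I : ideal A) : exists s : seq A,
  (forall b, b \in s -> b \in I) /\
  forall S : set (A^o : lmodType A), is_submod S ->
    (forall b, b \in s -> S b) -> forall a, a \in I -> S a.
Proof.
have [r [e eP]] := noethA I; exists [seq val (e i) : A | i <- enum 'I_r]; split.
  by move=> b /mapP[i _ ->]; apply: valP.
move=> S subS Ss a aI; have [c /(congr1 val)] := eP (Submod aI).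
rewrite raddf_sum /= => ->; elim/big_rec: _ => [|i x _ Sx].
  by case: subS.
apply: is_submodD Sx => //; apply: is_submodZ => //.
by apply: Ss; apply: map_f; rewrite mem_enum.
Qed.

Lemma ideal_acc :
  acc (fun L : unit -> set (A^o : lmodType A) => is_submod (L tt)).
Proof.
move=> L subL chainL; pose S : set (A^o : lmodType A) := \bigcup_t L t tt.
have subS : is_submod S.
  split=> [|a x y [s _ Lx] [t _ Ly]]; first by exists 0 => //; case: (subL 0).
  exists (maxn s t) => //; have [_] := subL (maxn s t); apply.
    exact: (chain_homo chainL (leq_maxl s t)).
  exact: (chain_homo chainL (leq_maxr s t)).
have [I IP] := is_submod_submodClosed subS.
have [gens [gensI gensP]] := noetherian_gens I.
have [r rP] : exists r, forall b, b \in gens -> L r tt b.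
  elim: gens gensI {gensP} => [|b gens IHg] gensI; first by exists 0.
  have [c cg|r rP] := IHg; first by apply: gensI; rewrite inE cg orbT.
  have /IP[t _ Lb] := gensI b (mem_head _ _).
  exists (maxn r t) => c; rewrite inE => /predU1P[->|/rP Lc].
    exact: (chain_homo chainL (leq_maxr r t)).
  exact: (chain_homo chainL (leq_maxl r t)).
exists r => t [] x Lx; apply: (gensP (L r tt)) => //.
by apply/IP; exists t.
Qed.

(** Induction on the number of generators: a member of the chain is controlled by its intersection
    with the span [S] of all generators but the last, and by the ideal [lead] of coefficients at the
    last one. *)
Lemma fg_acc (M : lmodType A) : fg_module M ->
  acc (fun L : unit -> set M => is_submod (L tt)).
Proof.
move=> [r [e eP]].
suff accr : acc (fun L : unit -> set M => is_submod (L tt) /\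
    L tt `<=` [set x | exists c : 'I_r -> A, x = \sum_i c i *: e i]).
  by apply: acc_sub accr => L subL; split=> // x _; apply: eP.
elim: r e {eP} => [|r IHr] e L LP chainL.
  exists 0 => t [] x /(proj2 (LP t))[c ->]; rewrite big_ord0.
  by case: (proj1 (LP 0)).
pose e' i := e (widen_ord (leqnSn r) i).
pose S := [set x | exists c : 'I_r -> A, x = \sum_i c i *: e' i].
have subS : is_submod S.
  split=> [|a x y [c ->] [c' ->]].
    by exists (fun=> 0); rewrite big1 // => i _; rewrite scale0r.
  exists (fun i => a * c i + c' i); rewrite scaler_sumr -big_split /=.
  by apply: eq_bigr => i _; rewrite scalerDl scalerA.
pose lead (K : set M) : set (A^o : lmodType A) :=
  [set a | exists2 z, S z & K ((a : A) *: e ord_max + z)].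
have [||r1 r1P] := IHr e' (fun t _ => L t tt `&` S).
- move=> t; split=> [|x []] //; apply: is_submodI => //; exact: (LP t).1.
- by move=> t [] x [Lx Sx]; split=> //; apply: chainL.
have [||r2 r2P] := ideal_acc (L := fun t _ => lead (L t tt)).
- move=> t; split=> [|a x y [z Sz Lz] [z' Sz' Lz']].
    exists 0; first by case: subS.
    by rewrite scale0r addr0; case: (LP t).1.
  exists (a *: z + z'); first by case: subS => _; apply.
  rewrite scalerDl addrACA -scalerA -scalerDr.
  by case: (LP t).1 => _; apply.
- by move=> t [] a [z Sz Lz]; exists z => //; apply: chainL.
exists (maxn r1 r2) => t [] x Lx.
have [c xE] := (LP t).2 _ Lx.
pose y := \sum_(i < r) c (widen_ord (leqnSn r) i) *: e' i.
have Sy : S y by exists (c \o widen_ord (leqnSn r)).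
have {}xE : x = c ord_max *: e ord_max + y by rewrite xE big_ord_recr addrC.
have [|z Sz Lz] := r2P t tt (c ord_max); first by exists y => //; rewrite -xE.
have homo := chain_homo chainL.
have Lz' : L (maxn r1 r2) tt (c ord_max *: e ord_max + z).
  exact: homo (leq_maxr r1 r2) _ _ Lz.
have -> : x = (c ord_max *: e ord_max + z) + (y - z).
  by rewrite addrA addrAC xE addrK.
apply: is_submodD Lz' _; first exact: (LP _).1.
apply: (homo _ _ (leq_maxl r1 r2)).
suff [] : (L r1 tt `&` S) (y - z) by [].
(* [y - z] is a difference of elements of [L t] and [L r2], so stage [maxn t r2] contains it. *)
apply: (r1P (maxn t r2) tt); split; last exact: is_submodB.
have -> : y - z = x - (c ord_max *: e ord_max + z).
  by rewrite xE opprD addrACA subrr add0r.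
apply: is_submodB; first exact: (LP _).1.
  exact: homo (leq_maxl t r2) _ _ Lx.
exact: homo (leq_maxr t r2) _ _ Lz.
Qed.

End Noetherian.

(** * Hilbert's basis theorem for graded families *)

Section GradedFamilies.
Context {A : comPzRingType} {M : lmodType A} {d : nat}.
Local Notation D := {ffun 'I_d -> nat}.
Implicit Types (L E : D -> set M) (ops : seq (A * D)) (m e : D) (a : A).

(** Each pair (a, e) in [ops] is a variable of degree e acting as multiplication by a; L is a graded
    submodule over the polynomial ring in these variables. *)
Definition graded ops L := (forall m, is_submod (L m)) /\
  forall p, p \in ops -> forall m x, L m x -> L (m + p.2) (p.1 *: x).

Definition graded_noetherian ops E :=
  acc (fun L => graded ops L /\ subfam L E).

Lemma ffun_addIr m : injective (+%R^~ m).
Proof.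
move=> n n' /ffunP enn'; apply/ffunP => i.
by have /eqP := enn' i; rewrite !ffunE /= eqn_add2r => /eqP.
Qed.

(* The degree [m] part of the polynomials of degree [< n] in a variable of    *)
(* degree [e], with coefficients in E, evaluated at [a].                      *)
Fixpoint below E a e n m : set M :=
  if n is n'.+1 then
    [set x | exists2 z, below E a e n' m z & x = z \/
       exists m' y, [/\ m = m' + e *+ n', E m' y & x = a ^+ n' *: y + z]]
  else [set 0].

Definition adjoin E a e m : set M := \bigcup_n below E a e n m.

Section Below.
Context (E : D -> set M) (ops : seq (A * D)) (a : A) (e : D).
Context (gradE : graded ops E).

Lemma below_submod n m : is_submod (below E a e n m).
Proof.
elim: n m => [|n IHn] m /=.
  by split=> // b x y -> ->; rewrite scaler0 addr0.
have [B0 BP] := IHn m; split=> [|b x y]; first by exists 0 => //; left.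
have addE m' w w' : E m' w -> E m' w' -> E m' (b *: w + w').
  by move=> Ew Ew'; case: (gradE.1 m') => _; apply.
move=> [z Bz xE] [z' Bz' yE]; exists (b *: z + z'); first exact: BP.
case: xE yE => [->|[m' [w [mE Ew ->]]]] [->|[m'' [w' [mE' Ew' ->]]]].
- by left.
- right; exists m'', w'; split=> //; by rewrite addrCA.
- right; exists m', (b *: w); split=> //.
    by apply: is_submodZ => //; apply: gradE.1.
  by rewrite scalerDr !scalerA mulrC addrA.
right; exists m', (b *: w + w').
(* Cancellation makes the coefficients live in the same degree, so they can be added. *)
have mm' : m' = m'' by exact: ffun_addIr (etrans (esym mE) mE').
rewrite -mm' in Ew'; split; [exact: mE|exact: addE|].
by rewrite !scalerDr !scalerA [b * _]mulrC addrACA.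
Qed.

Lemma below_op n m p x : p \in ops ->
  below E a e n m x -> below E a e n (m + p.2) (p.1 *: x).
Proof.
move=> pP; elim: n m x => [|n IHn] m x /=; first by move->; rewrite scaler0.
move=> [z Bz xE]; exists (p.1 *: z); first exact: IHn.
case: xE => [->|[m' [y [-> Ey ->]]]]; [by left|right].
exists (m' + p.2), (p.1 *: y); split; first by rewrite addrAC.
  exact: gradE.2.
by rewrite scalerDr !scalerA mulrC.
Qed.

Lemma below_shift n m x :
  below E a e n m x -> below E a e n.+1 (m + e) (a *: x).
Proof.
elim: n m x => [|n IHn] m x.
  by move=> ->; rewrite scaler0; case: (below_submod 1 (m + e)).
move=> [z Bz xE]; exists (a *: z); first exact: IHn.
case: xE => [->|[m' [y [-> Ey ->]]]]; [by left|right].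
exists m', y; split=> //; first by rewrite mulrSr addrA.
by rewrite scalerDr scalerA exprS.
Qed.

Lemma below_leq n n' m x : (n <= n')%N ->
  below E a e n m x -> below E a e n' m x.
Proof.
elim: n' => [|n' IHn']; first by rewrite leqn0 => /eqP->.
rewrite leq_eqVlt => /predU1P[->|] //; rewrite ltnS => /IHn' Bn /Bn Bn'.
by exists x => //; left.
Qed.

Lemma adjoin_sub : subfam E (adjoin E a e).
Proof.
move=> m x Ex; exists 1 => //; exists 0 => //; right; exists m, x.
by rewrite mulr0n !addr0 expr0 scale1r.
Qed.

Lemma adjoin_graded : graded ((a, e) :: ops) (adjoin E a e).
Proof.
split=> [m|p].
  split=> [|b x y [n _ Bx] [n' _ By]]; first by exists 0.
  exists (maxn n n') => //; have [_] := below_submod (maxn n n') m; apply.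
    exact: below_leq (leq_maxl _ _) Bx.
  exact: below_leq (leq_maxr _ _) By.
rewrite inE => /predU1P[->|pP] m x [n _ Bx]; [exists n.+1|exists n] => //.
  exact: below_shift.
exact: below_op.
Qed.

(* Coefficients of [a ^+ s] in those elements of L of degree [<= s] in [a]. *)
Definition lead L s m : set M := [set y | E m y /\
  exists2 z, below E a e s (m + e *+ s) z & L (m + e *+ s) (a ^+ s *: y + z)].

Lemma lead_graded L s : graded ((a, e) :: ops) L -> graded ops (lead L s).
Proof.
move=> [subL opL]; split=> [m|p pP m y [Ey [z Bz Lz]]].
  split=> [|b x y [Ex [z Bz Lz]] [Ey [z' Bz' Lz']]].
    split; first by case: (gradE.1 m).
    exists 0; first by case: (below_submod s (m + e *+ s)).
    by rewrite scaler0 addr0; case: (subL (m + e *+ s)).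
  split; first by case: (gradE.1 m) => _; apply.
  exists (b *: z + z').
    by case: (below_submod s (m + e *+ s)) => _; apply.
  rewrite scalerDr scalerA mulrC -scalerA addrACA -scalerDr.
  by case: (subL (m + e *+ s)) => _; apply.
split; first exact: gradE.2.
exists (p.1 *: z); first by rewrite addrAC; apply: below_op.
rewrite scalerA mulrC -scalerA -scalerDr addrAC; apply: opL => //.
by rewrite inE pP orbT.
Qed.

Lemma lead_chain L s : graded ((a, e) :: ops) L ->
  subfam (lead L s) (lead L s.+1).
Proof.
move=> [subL opL] m y [Ey [z Bz Lz]]; split=> //.
rewrite mulrSr addrA; exists (a *: z); first exact: below_shift.
rewrite exprS -scalerA -scalerDr.
by have /= := opL (a, e) (mem_head _ _) _ _ Lz.
Qed.

(** The leading coefficients grow with the chain and, through multiplication by a, with the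
    exponent. The diagonal argument stabilizes them for all exponents at once, and subtracting
    leading terms lowers the exponent. *)
Lemma adjoin_noetherian :
  graded_noetherian ops E -> graded_noetherian ((a, e) :: ops) (adjoin E a e).
Proof.
move=> noethE L LP chainL.
have [|||r rP] := acc_diag (L := fun t s => lead (L t) s) noethE.
- move=> t s; split; first exact: lead_graded (LP t).1.
  by move=> m y [].
- move=> t s m y [Ey [z Bz Lz]]; split=> //; exists z => //.
  exact: chainL.
- by move=> t s; apply: lead_chain (LP t).1.
(* The subtraction takes place in [L t] and uses elements of [L r], hence needs r <= t. *)
exists r => t; case: (leqP t r) => [tr|/ltnW rt].
  exact: (chain_homo chainL tr).
suff leadE n m x : below E a e n m x -> L t m x -> L r m x.
  by move=> m x Lx; have [n _ /leadE] := (LP t).2 m x Lx; apply.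
elim: n m x => [|n IHn] m x /=.
  by move=> -> _; have [] := (LP r).1.1 m.
move=> [z Bz [->|[m' [y [mE Ey ->]]]]]; first exact: IHn.
rewrite mE in Bz * => Lx.
have [|_ [z' Bz' Lz']] := rP t n m' y; first by split=> //; exists z.
have subB := below_submod n (m' + e *+ n).
have -> : a ^+ n *: y + z = (a ^+ n *: y + z') + (z - z').
  by rewrite addrACA subrr addr0.
apply: is_submodD (Lz') _; first exact: (LP r).1.1.
apply: IHn; first exact: is_submodB.
have -> : z - z' = (a ^+ n *: y + z) - (a ^+ n *: y + z').
  by rewrite opprD addrACA subrr add0r.
apply: is_submodB => //; first exact: (LP t).1.1.
exact: (chain_homo chainL rt) _ _ Lz'.
Qed.

End Below.

(* Hilbert's basis theorem for M[x_1, ..., x_r], the variables being given    *)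
(* the degrees and the values recorded in [ops].                              *)
Lemma graded_basis ops :
  acc (fun L : unit -> set M => is_submod (L tt)) ->
  exists E, [/\ graded ops E, graded_noetherian ops E & forall x, E 0 x].
Proof.
move=> accM; elim: ops => [|[a e] ops [E [gradE noethE E0]]]; last first.
  exists (adjoin E a e); split; first exact: adjoin_graded.
    exact: adjoin_noetherian.
  by move=> x; apply: adjoin_sub.
(* Without variables: M concentrated in degree 0. *)
exists (fun m => [set x | m = 0 \/ x = 0]); split.
- split=> // m; split=> [|b x y]; first by right.
  move=> [->|->]; first by left.
  by move=> [->|->]; [left|right]; rewrite ?scaler0 ?addr0.
- move=> L LP chainL.
  have [||r rP] := accM (fun t _ => L t 0).
  + by move=> t; apply: (LP t).1.1.
  + by move=> t _; apply: chainL.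
  exists r => t m x Lx; have [m0|->] := (LP t).2 m x Lx.
    by rewrite m0 in Lx *; apply: (rP t tt).
  by case: ((LP r).1.1 m).
- by left.
Qed.

End GradedFamilies.

(** * Products of ideals and multi-indices *)

Section IdealProducts.
Context {A : comPzRingType}.
Implicit Types (I K : ideal A).

Lemma idmulA (M : lmodType A) I K (N : submodClosed M) :
  idmul I (idmul K N) = idmul (idmul I K) N.
Proof.
apply: submodClosed_ext => x; apply/idP/idP; move: x.
  apply: idmul_ind; first exact: is_submod_mem.
  move=> a x aI; move: x; apply: idmul_ind.
    split=> [|b x y xP yP]; first by rewrite scaler0 rpred0.
    by rewrite scalerDr scalerA mulrC -scalerA rpredD // rpredZ.
  move=> b x bK xN; rewrite scalerA; apply: idmul_mem => //.
  exact: (@idmul_mem A A^o).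
apply: idmul_ind; first exact: is_submod_mem.
move=> a x aIK xN; move: a aIK; apply: (@idmul_ind A A^o).
  split=> [|b a c aP cP]; first by rewrite scale0r rpred0.
  by rewrite scalerDl -scalerA rpredD // rpredZ.
by move=> b c bI cK; rewrite -scalerA; apply/idmul_mem/idmul_mem.
Qed.

Lemma idmulC : commutative (@idmul A A^o).
Proof.
suff sub I K x : x \in idmul I K -> x \in idmul K I.
  by move=> I K; apply: submodClosed_ext => x; apply/idP/idP; apply: sub.
move: x; apply: (@idmul_ind A A^o); first exact: is_submod_mem.
by move=> a b aI bK; rewrite /GRing.scale/= mulrC; apply: (@idmul_mem A A^o).
Qed.

Lemma idmul1 (M : lmodType A) (N : submodClosed M) :
  idmul (fullmod : ideal A) N = N.
Proof.
apply: submodClosed_ext => x; apply/idP/idP; move: x.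
  apply: idmul_ind; first exact: is_submod_mem.
  by move=> a x _ xN; rewrite rpredZ.
by move=> x xN; rewrite -[x]scale1r; apply: idmul_mem.
Qed.

HB.instance Definition _ := Monoid.isComLaw.Build (ideal A) fullmod
  (@idmul A A^o) (@idmulA A^o) idmulC (@idmul1 A^o).

Lemma idealXD I p q : idealX I (p + q) = idmul (idealX I p) (idealX I q).
Proof.
elim: p => [|p IHp]; first by rewrite idmul1.
by rewrite addSn /idealX !iterS -/(idealX I _) IHp idmulA.
Qed.

Context {d : nat} (J : 'I_d -> ideal A).
Implicit Types (m n k : {ffun 'I_d -> nat}).

Definition delta (i : 'I_d) : {ffun 'I_d -> nat} :=
  [ffun j => nat_of_bool (j == i)].

Lemma mpowD m n : mpow J (m + n) = idmul (mpow J m) (mpow J n).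
Proof.
rewrite /mpow -big_split /=; apply: eq_bigr => i _.
by rewrite ffunE idealXD.
Qed.

Lemma mpow_delta i : mpow J (delta i) = J i.
Proof.
rewrite /mpow (bigD1 i) //= big1 => [|j /negPf ji]; last by rewrite ffunE ji.
by rewrite ffunE eqxx /idealX /= [LHS]idmulC idmul1 idmulC idmul1.
Qed.

Lemma mpow0 : mpow J 0 = fullmod.
Proof. by rewrite /mpow big1 // => i _; rewrite ffunE. Qed.

Lemma mle_refl n : mle n n.
Proof. by move=> i. Qed.

Lemma mle_trans k m n : mle k m -> mle m n -> mle k n.
Proof. by move=> km mn i; apply: leq_trans (km i) (mn i). Qed.

Lemma mle_addr m n : mle m (m + n).
Proof. by move=> i; rewrite ffunE leq_addr. Qed.

(** Comparable multi-indices are joined by unit steps; the induction is on the total distance. The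
    path stays below n, which the step may use. *)
Lemma mle_walk k n (P : {ffun 'I_d -> nat} -> Prop) : mle k n -> P k ->
  (forall m i, mle k m -> mle (m + delta i) n -> P m -> P (m + delta i)) -> P n.
Proof.
move: {2}(\sum_i (n i - k i))%N (leqnn (\sum_i (n i - k i))%N) => s.
elim: s n => [|s IHs] n ns kn Pk PS.
  suff -> : n = k by [].
  apply/ffunP => i; apply/eqP; rewrite eqn_leq kn andbT -subn_eq0.
  by move: ns; rewrite leqn0 sum_nat_eq0 => /forallP/(_ i).
case: (pselect (exists i, (k i < n i)%N)) => [[i kni]|nkn]; last first.
  suff -> : n = k by [].
  apply/ffunP => i; apply/eqP; rewrite eqn_leq kn andbT leqNgt.
  by apply/negP => kni; apply: nkn; exists i.
pose m : {ffun 'I_d -> nat} := [ffun j => (n j - (j == i))%N].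
have nE : n = m + delta i.
  apply/ffunP => j; rewrite !ffunE; apply/esym/subnK.
  by case: eqP => // ->; apply: leq_ltn_trans kni.
have km : mle k m.
  move=> j; rewrite ffunE; case: eqP => [->|_]; last by rewrite subn0.
  by rewrite subn1 -ltnS prednK // (leq_ltn_trans _ kni).
rewrite nE; apply: (PS) => //; first by rewrite -nE; apply: mle_refl.
apply: IHs => //.
  move: ns; rewrite (bigD1 i) //= [in X in _ -> X](bigD1 i) //=.
  rewrite (eq_bigr (fun j => m j - k j)%N) => [|j /negPf ji]; last first.
    by rewrite ffunE ji subn0.
  by rewrite ffunE eqxx subn1 -subn1 subnAC -(subnSK kni) addSn subn1.
move=> l j kl ln; apply: PS => //; apply: mle_trans ln _.
by rewrite nE; apply: mle_addr.
Qed.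

End IdealProducts.

(** * The Rees module *)

Section ReesModule.
Context {A : comPzRingType} {C : lmodType A} {d : nat} (J : 'I_d -> ideal A).
Local Notation D := {ffun 'I_d -> nat}.
Implicit Types (L N : D -> set C) (m n k : D).

Definition rees m : set C :=
  [set x | x \in idmul (mpow J m) (fullmod : submodClosed C)].

Definition jgraded L := (forall m, is_submod (L m)) /\
  forall i a m x, a \in J i -> L m x -> L (m + delta i) (a *: x).

Lemma reesS m i : rees (m + delta i) =
  [set x | x \in idmul (J i) (idmul (mpow J m) (fullmod : submodClosed C))].
Proof. by rewrite /rees idmulA mpowD mpow_delta idmulC. Qed.

Lemma rees_jgraded : jgraded rees.
Proof.
split=> [m|i a m x aJ xm]; first exact: is_submod_mem.
by rewrite reesS; apply: idmul_mem.
Qed.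

Lemma rees0 x : rees 0 x.
Proof. by rewrite /rees mpow0 idmul1. Qed.

Lemma reesSW m i : rees (m + delta i) `<=` rees m.
Proof.
rewrite reesS; apply: idmul_ind.
  exact: is_submod_mem.
by move=> a x _; apply: rpredZ.
Qed.

Lemma rees_mle m n : mle m n -> rees n `<=` rees m.
Proof.
move=> mn; apply: (mle_walk (P := fun n => rees n `<=` rees m) mn) => //.
by move=> l i _ _ sl x /reesSW/sl.
Qed.

(** Finitely many generators of each J_i serve as variables of degree [delta i]. The resulting
    Noetherian family contains C in degree 0, hence J^m C in degree m. *)
Lemma rees_acc : noetherian A -> fg_module C ->
  acc (fun L => jgraded L /\ subfam L rees).
Proof.
move=> noethA fgC; have [g gP] := choice (fun i => noetherian_gens noethA (J i)).
pose ops := flatten [seq [seq (b, delta i) | b <- g i] | i <- enum 'I_d].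
have opsP i b : b \in g i -> (b, delta i) \in ops.
  move=> bg; apply/flatten_mapP; exists i; first by rewrite mem_enum.
  exact: map_f.
have [E [[subE opE] noethE E0]] := graded_basis ops (fg_acc noethA fgC).
apply: acc_sub noethE => L [[subL opL] Lrees]; split.
  split=> // p /flatten_mapP[i _ /mapP[b bg ->]] m x; apply: opL.
  exact: (gP i).1.
apply: subfam_trans Lrees _ => m.
have m0 : mle 0 m by move=> i; rewrite ffunE.
apply: (mle_walk (P := fun m => rees m `<=` E m) m0) => // {m0} n i _ _ IHn.
rewrite reesS; apply: idmul_ind => // a x aJ xn.
move: a aJ; apply: (gP i).2 => [|b bg].
  split=> [|a b c Eb Ec]; first by rewrite scale0r; case: (subE (n + delta i)).
  by rewrite scalerDl -scalerA; case: (subE (n + delta i)) => _; apply.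
by apply: opE (opsP i b bg) _ _ _; apply: IHn.
Qed.

Definition is_ann (P : ideal A) (S : set C) x :=
  forall a : A, a \in P <-> S (a *: x).

(** For b outside the prime P, (S : b x) = (P : b) = P; this moves a witness into smaller
    submodules. *)
Lemma is_ann_scale P S x b :
  prime_ideal P -> b \notin P -> is_ann P S x -> is_ann P S (b *: x).
Proof.
move=> [_ primeP] bP annx a; rewrite scalerA -(annx (a * b)); split=> [aP|].
  by rewrite mulrC; apply: (@rpredZ A A^o).
by move/primeP => [] //; rewrite (negPf bP).
Qed.

Lemma is_ann_notin P S x : prime_ideal P -> is_ann P S x -> ~ S x.
Proof. by move=> [/negP P1 _] annx Sx; apply/P1/annx; rewrite scale1r. Qed.

(** * Torsion in high degrees *)

Hypotheses (noethA : noetherian A) (fgC : fg_module C).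

(* For fixed i and j, the classes of [rees m] modulo [rees (m + delta j)]     *)
(* killed by [J i] in the associated graded module form a finitely generated  *)
(* submodule killed by [J i], which therefore vanishes for large [m i].       *)
Lemma rees_torsion i j : exists k : nat, forall m x, (k < m i)%N ->
  rees m x -> (forall a, a \in J i -> rees (m + delta j + delta i) (a *: x)) ->
  rees (m + delta j) x.
Proof.
have [subR opR] := rees_jgraded.
pose H m := [set x | rees m x /\
  forall a, a \in J i -> rees (m + delta j + delta i) (a *: x)].
have subH m : is_submod (H m).
  split=> [|b x y [Rx Hx] [Ry Hy]].
    split=> [|a _]; rewrite ?scaler0; [by case: (subR m)|].
    by case: (subR (m + delta j + delta i)).
  split; first by case: (subR m) => _; apply.
  move=> a aJ; rewrite scalerDr scalerA mulrC -scalerA.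
  by case: (subR (m + delta j + delta i)) => _; apply; [apply: Hx|apply: Hy].
have RH m : rees (m + delta j) `<=` H m.
  by move=> x Rx; split=> [|a aJ]; [apply: reesSW Rx|apply: opR].
(* This is graded because only J_i can cross the threshold m i = t, and it sends [H m] into the
   smaller part. Stability from stage k on forces [H m] into [rees (m + delta j)] when m i > k. *)
pose L (t : nat) m := if (m i <= t)%N then H m else rees (m + delta j).
have [||k kP] := rees_acc noethA fgC (L := L).
- move=> t; split; last first.
    move=> m x; rewrite /L; case: ifP => _; first by case.
    exact: reesSW.
  split=> [m|l a m x aJ]; first by rewrite /L; case: ifP.
  rewrite /L; case: (leqP (m i) t) => [mt [Rx Hx]|tm Rx]; last first.
    rewrite ifN; first by rewrite addrAC; apply: opR.
    by rewrite -ltnNge ffunE ltn_addr.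
  case: ifP => [_|/negbT mt'].
    split=> [|b bJ]; first exact: opR.
    rewrite scalerA mulrC -scalerA -!addrA [delta l + _]addrC !addrA.
    by apply: opR => //; apply: Hx.
  have il : i == l.
    move: mt'; rewrite !ffunE; case: (i == l) => //.
    by rewrite [(_ + _)%R]addn0 mt.
  by rewrite addrAC -(eqP il); apply: Hx; rewrite (eqP il).
- move=> t m x; rewrite /L; case: ifP => [mt|_]; first by rewrite (leqW mt).
  by case: ifP => // _ /RH.
exists k => m x km Rx Hx; have := kP (m i) m x.
by rewrite /L leqnn leqNgt km; apply.
Qed.

(** Climb from k to n by unit steps: on the way to m + delta j <= n, the hypothesis on J_i x is
    stronger than what [rees_torsion] asks for. *)
Lemma rees_colon : exists k, forall n i x, mle k n -> rees k x ->
  (forall a, a \in J i -> rees (n + delta i) (a *: x)) -> rees n x.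
Proof.
have [T TP] := choice (fun p : 'I_d * 'I_d => rees_torsion p.1 p.2).
(* The successor gives the strict bound of [rees_torsion], the maximum covers every direction j of a
   step. *)
exists [ffun i => (\max_j T (i, j)).+1] => n i x kn Rx Jx.
set k := (X in mle X n) in kn Rx.
apply: (mle_walk (P := fun m => rees m x) kn Rx) => m j km mn Rmx.
apply: (TP (i, j)) => //=.
  apply: leq_trans (km i); rewrite ffunE ltnS.
  exact: (leq_bigmax (F := fun j => T (i, j))).
move=> a aJ; apply: rees_mle (Jx a aJ) => l.
by rewrite !ffunE leq_add2r; have := mn l; rewrite !ffunE.
Qed.

(** * Finiteness of the set of associated primes *)

Definition assoc L : set (ideal A) :=
  [set P | prime_ideal P /\ exists m x, rees m x /\ is_ann P (L m) x].

(* Noetherian induction on L: if Q is maximal among the annihilators of       *)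
(* elements outside L, then adding to L everything killed by Q modulo L       *)
(* removes at most the associated prime Q.                                    *)
Lemma assoc_finite L : jgraded L -> subfam L rees -> finite_set (assoc L).
Proof.
move=> gradL sL; apply: contrapT => infL.
pose bad L := [/\ jgraded L, subfam L rees & ~ finite_set (assoc L)].
have [|//|{}L {gradL sL infL} [[subL opL] sL infL] Lmax] :=
  @acc_max _ _ _ bad L (rees_acc noethA fgC); first by move=> N [].
pose colon m x : set (A^o : lmodType A) := [set a | L m ((a : A) *: x)].
have subcolon m x : is_submod (colon m x).
  split=> [|b a c La Lc]; rewrite /colon /=.
    by rewrite scale0r; case: (subL m).
  by rewrite scalerDl -scalerA; case: (subL m) => _; apply.
pose cand (K : unit -> set (A^o : lmodType A)) :=
  exists m x, [/\ rees m x, ~ L m x & K = fun=> colon m x].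
have [P0 [primeP0 [m0 [x0 [Rx0 /(is_ann_notin primeP0) Lx0]]]]] : assoc L !=set0.
  apply/set0P/eqP => L0; apply: infL; rewrite L0; exact: finite_set0.
have [||K [m [x [Rx Lx ->]]] Qmax] :=
    @acc_max _ _ _ cand (fun=> colon m0 x0) (ideal_acc noethA).
- by move=> K [m [x [_ _ ->]]].
- by exists m0, x0.
pose Q := colon m x; have {}Qmax n y : rees n y -> ~ L n y ->
    (forall a, Q a -> L n (a *: y)) -> forall a : A, L n (a *: y) -> Q a.
  move=> Ry Ly QL a; apply: (Qmax (fun=> colon n y) _ _ tt a).
    by exists n, y.
  by move=> _ b; apply: QL.
pose L' n := [set y | rees n y /\ forall a, Q a -> L n (a *: y)].
have [subR opR] := rees_jgraded.
have sLL' : subfam L L'.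
  by move=> n y Ly; split=> [|a _]; [apply: sL|exact: is_submodZ (subL n) Ly].
have L'x : L' m x by split.
have gradL' : jgraded L'.
  split=> [n|i a n y aJ [Ry QLy]]; last first.
    split=> [|b Qb]; first exact: opR.
    by rewrite scalerA mulrC -scalerA; apply/opL/QLy.
  split=> [|b y z [Ry QLy] [Rz QLz]].
    by split=> [|a _]; rewrite ?scaler0; [case: (subR n)|case: (subL n)].
  split; first by case: (subR n) => _; apply.
  move=> a Qa; rewrite scalerDr scalerA mulrC -scalerA.
  by case: (subL n) => _; apply; [apply: QLy|apply: QLz].
have finL' : finite_set (assoc L').
  apply: contrapT => infL'; apply: Lx; apply: (Lmax L') L'x => //.
  by split=> // n y [].
apply: infL; pose isQ := [set P : ideal A | forall a, a \in P <-> Q a].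
apply: (@sub_finite_set _ _ (assoc L' `|` isQ)); last first.
  rewrite finite_setU; split=> //.
  have [[P PQ]|noQ] := pselect (isQ !=set0); last first.
    suff -> : isQ = set0 by exact: finite_set0.
    by apply/eqP/negPn/negP => /set0P.
  apply: sub_finite_set (finite_set1 P) => P' P'Q; apply: submodClosed_ext => a.
  by apply/idP/idP; [move/P'Q/PQ|move/PQ/P'Q].
move=> P [primeP [n [y [Ry annP]]]].
(* If a multiple b y with b outside P enters [L'], then P is its annihilator modulo [L] and
   maximality gives P = Q; otherwise P is still the annihilator of y modulo [L']. *)
have [[b [L'by bP]]|nb] := pselect (exists b, L' n (b *: y) /\ b \notin P).
  right; have annby := is_ann_scale primeP bP annP.
  have [Rby QLby] := L'by => a; rewrite annby; split; last exact: QLby.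
  exact: Qmax Rby (is_ann_notin primeP annby) QLby a.
left; split=> //; exists n, y; split=> // a; split; first by move/annP/sLL'.
by move=> L'ay; apply: contrapT => /negP aP; apply: nb; exists a.
Qed.


Lemma assoc_rees_step_finite j :
  finite_set (assoc (fun m => rees (m + delta j))).
Proof.
have [subR opR] := rees_jgraded; apply: assoc_finite => [|m]; last exact: reesSW.
by split=> // i a m x aJ Rx; rewrite addrAC; apply: opR.
Qed.

(* An associated prime of C / J^n C is one of a quotient                      *)
(* J^m C / J^(m + delta j) C occurring in a chain from C down to J^n C.       *)
Lemma assoc_rees_quotient P n x : prime_ideal P -> is_ann P (rees n) x ->
  (\bigcup_j assoc (fun m => rees (m + delta j))) P.
Proof.
move=> primeP annx; apply: contrapT => nP.
suff [y [Ry anny]] : exists y, rees n y /\ is_ann P (rees n) y.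
  exact: is_ann_notin primeP anny Ry.
have n0 : mle 0 n by move=> i; rewrite ffunE.
apply: (mle_walk (P := fun m => exists y, rees m y /\ is_ann P (rees n) y) n0).
  by exists x; split=> //; apply: rees0.
move=> m j _ mn [y [Ry anny]]; apply: contrapT => noy; apply: nP.
exists j => //; split=> //; exists m, y; split=> // a.
split=> [/anny|Ray]; first exact: rees_mle.
apply: contrapT => /negP aP; apply: noy; exists (a *: y); split=> //.
exact: is_ann_scale.
Qed.

(** * Stabilization; [N] stands for the family I_n C *)

Context (N : D -> set C).
Hypotheses (gradN : jgraded N) (antiN : forall m n, mle m n -> N n `<=` N m).

Definition assoc_at n : set (ideal A) :=
  [set P | prime_ideal P /\ exists x, N n x /\ is_ann P (rees n) x].

Definition assoc_above k n : set (ideal A) := [set P | prime_ideal P /\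
  exists x, [/\ N n x, rees k x & is_ann P (rees n) x]].

Lemma assoc_above_at k n : assoc_above k n `<=` assoc_at n.
Proof. by move=> P [primeP [x [Nx _ annx]]]; split=> //; exists x. Qed.

(* If no [a \in J i] worked in place of x, then some [s \notin P] would       *)
(* satisfy [J i (s x) <= J^(n + delta i) C], so that [s x] would lie in       *)
(* [J^n C] by [rees_colon]; this replaces localization at P.                  *)
Lemma assoc_above_homo k m n :
    (forall n i x, mle k n -> rees k x ->
      (forall a, a \in J i -> rees (n + delta i) (a *: x)) -> rees n x) ->
  mle k m -> mle m n -> assoc_above k m `<=` assoc_above k n.
Proof.
move=> colonk km mn P Pm.
apply: (mle_walk (P := fun n => assoc_above k n P) mn) => // {n mn Pm} n i mn _.
move=> [primeP [x [Nx Rx annx]]]; have kn := mle_trans km mn.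
have [subR opR] := rees_jgraded.
suff [a [aJ annax]] : exists a,
    a \in J i /\ is_ann P (rees (n + delta i)) (a *: x).
  split=> //; exists (a *: x); split=> //; first exact: gradN.2.
  exact: is_submodZ (subR k) Rx.
apply: contrapT => noa.
have kill a : a \in J i ->
    exists2 b, b \notin P & rees (n + delta i) (b *: (a *: x)).
  move=> aJ; apply: contrapT => nob; apply: noa; exists a; split=> // b.
  split=> [/annx Rbx|Rbax]; first by rewrite scalerA mulrC -scalerA; apply: opR.
  by apply: contrapT => /negP bP; apply: nob; exists b.
have [g [gJ gP]] := noetherian_gens noethA (J i).
(* The product of the multipliers of finitely many generators stays outside P by primality. *)
have [s sP sg] : exists2 s, s \notin P &
    forall a, a \in g -> rees (n + delta i) (s *: (a *: x)).
  elim: g gJ {gP} => [|a g IHg] gJ; first by exists 1 => //; case: primeP.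
  have [b bg|s sP sg] := IHg; first by apply: gJ; rewrite inE bg orbT.
  have [b bP Rb] := kill a (gJ a (mem_head _ _)).
  exists (s * b); first by apply/negP => /primeP.2 []; apply/negP.
  move=> c; rewrite inE => /predU1P[->|/sg Rc].
    by rewrite -scalerA; apply: is_submodZ (subR _) Rb.
  by rewrite mulrC -scalerA; apply: is_submodZ (subR _) Rc.
have /negP := sP; apply; apply/annx; apply: (colonk n i) => //.
  exact: is_submodZ (subR k) Rx.
apply: gP => [|a /sg]; last by rewrite !scalerA mulrC.
split=> [|b a c Rb Rc]; first by rewrite scale0r; case: (subR (n + delta i)).
by rewrite scalerDl -scalerA; case: (subR (n + delta i)) => _; apply.
Qed.

(** Either a multiple of the witness x by an element outside P lies in J^m C, hence in J^k C, or P
    is already the annihilator of x modulo J^m C. *)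
Lemma assoc_at_anti k m n : mle k m -> mle m n ->
  assoc_at n `<=` assoc_at m `|` assoc_above k n.
Proof.
move=> km mn P [primeP [x [Nx annx]]].
have [[b [bP Rbx]]|nb] := pselect (exists b, b \notin P /\ rees m (b *: x)).
  right; split=> //; exists (b *: x); split; last exact: is_ann_scale.
    exact: is_submodZ (gradN.1 n) Nx.
  exact: rees_mle Rbx.
left; split=> //; exists x; split=> [|a]; first exact: antiN Nx.
split=> [/annx|Rax]; first exact: rees_mle.
by apply: contrapT => /negP aP; apply: nb; exists a.
Qed.

(** A prime with a witness in J^k C persists. Failing that, membership is decreasing in the degree,
    so P either drops out for good or is always present. *)
Lemma assoc_at_eventually P :
  exists k, forall n, mle k n -> assoc_at n P <-> assoc_at k P.
Proof.
have [k colonk] := rees_colon.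
have [[m [km Pm]]|noM] := pselect (exists m, mle k m /\ assoc_above k m P).
  exists m => n mn; split=> _; first exact: assoc_above_at Pm.
  exact: assoc_above_at (assoc_above_homo colonk km mn Pm).
have [[m [km Pm]]|allP] := pselect (exists m, mle k m /\ ~ assoc_at m P).
  exists m => n mn; split=> // /(assoc_at_anti km mn)[//|Pn].
  by case: noM; exists n; split=> //; apply: mle_trans mn.
have atP n : mle k n -> assoc_at n P.
  by move=> kn; apply: contrapT => Pn; apply: allP; exists n.
by exists k => n kn; split=> _; apply: atP.
Qed.

Lemma assoc_at_stable : exists k, forall n, mle k n -> assoc_at n = assoc_at k.
Proof.
have [K KP] := choice assoc_at_eventually.
have finX : finite_set (\bigcup_j assoc (fun m => rees (m + delta j))).
  apply: bigcup_finite => // j _; exact: assoc_rees_step_finite.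
have /(@finite_seqP {classic ideal A})[s sE] := finX.
pose k : D := [ffun i => \max_(P <- s) K P i].
exists k => n kn.
(* The right-hand condition does not mention n', so it compares degrees n and k. *)
suff stable P n' : mle k n' -> assoc_at n' P <-> (assoc_at (K P) P /\ P \in s).
  apply/funext => P; apply/propext.
  by rewrite (stable P n kn) (stable P k (mle_refl k)).
move=> kn'; split=> [Pn'|[PK Ps]].
  have Ps : P \in s.
    have [primeP [x [_ annx]]] := Pn'.
    have := assoc_rees_quotient primeP annx; by rewrite sE.
  split=> //; apply/(KP P n') => // i; apply: leq_trans (kn' i).
  by rewrite ffunE; apply: (@leq_bigmax_seq _ s xpredT (fun P => K P i)).
apply/(KP P n') => // i; apply: leq_trans (kn' i).
by rewrite ffunE; apply: (@leq_bigmax_seq _ s xpredT (fun P => K P i)).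
Qed.

End ReesModule.

(** * Associated primes of subquotients, and the theorem *)

Local Open Scope quotient_scope.

Lemma ann_pi (A : comPzRingType) (M : lmodType A) (K : submodClosed M) (a : A) x :
  (a \in ann (\pi_(quotmod K) x : quotmod K)) = (a *: x \in K).
Proof.
have pi0 : \pi_(quotmod K) 0 = 0 :> quotmod K by exact: raddf0.
rewrite -[LHS]/(qscale a (\pi_(quotmod K) x) == 0 :> quotmod K) -pi0.
by rewrite qscaleE pi_eq subr0.
Qed.

Lemma Ass_subquot (A : comPzRingType) (M : lmodType A) (N L : submodClosed M)
    (P : ideal A) :
  Ass (subquot N L) P <->
  prime_ideal P /\ exists x, x \in N /\ is_ann P (fun y => y \in L) x.
Proof.
pose K : submodClosed (submod N) := comap_pred L.
have inK (u : submod N) a : (a *: u \in K) = (a *: val u \in L).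
  by rewrite -GRing.valZ.
split=> -[primeP [x xP]]; split=> //.
  exists (val (repr (x : quotmod K))); split; first exact: valP.
  by move=> a; rewrite xP -inK -ann_pi reprK.
case: xP => xN annx; exists (\pi_(quotmod K) (Submod xN)) => a.
rewrite [X in _ = X](ann_pi K a (Submod xN)) inK.
by apply/idP/idP => /annx.
Qed.

Theorem theorem5p4 (A : comPzRingType) (C : lmodType A) (d : nat)
    (J : 'I_d -> ideal A) (I : {ffun 'I_d -> nat} -> ideal A) :
  noetherian A -> fg_module C -> multi_filtration J I ->
  exists k : {ffun 'I_d -> nat}, forall n : {ffun 'I_d -> nat}, mle k n ->
    Ass (subquot (idmul (I n) (fullmod : submodClosed C))
                 (idmul (mpow J n) (fullmod : submodClosed C))) =
    Ass (subquot (idmul (I k) (fullmod : submodClosed C))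
                 (idmul (mpow J k) (fullmod : submodClosed C))).
Proof.
move=> noethA fgC [_ _ antiI mulI].
pose N n : set C := [set x | x \in idmul (I n) (fullmod : submodClosed C)].
(* Axiom (iv) for the exponent [delta i], where J^n is J_i itself. *)
have gradN : jgraded J N.
  split=> [n|i a n x aJ]; first exact: is_submod_mem.
  move: x; apply: idmul_ind.
    split=> [|b x y xP yP]; rewrite /N /= ?scaler0 ?rpred0 //.
    by rewrite scalerDr scalerA mulrC -scalerA rpredD // rpredZ.
  move=> b x bI xC; rewrite scalerA; apply: idmul_mem => //.
  rewrite addrC; apply: mulI; rewrite mpow_delta.
  exact: (@idmul_mem A A^o).
have antiN m n : mle m n -> N n `<=` N m.
  move=> mn; apply: idmul_ind; first exact: is_submod_mem.
  by move=> a x aI xC; apply: idmul_mem => //; apply: antiI aI.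
have [k kP] := assoc_at_stable noethA fgC gradN antiN.
exists k => n /kP assocE; apply/funext => P; apply/propext.
rewrite !Ass_subquot.
by have /(congr1 (fun X => X P)) := assocE; rewrite /assoc_at /=  => ->.
Qed.
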